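(* Let $F,G\in\mathcal{F}^{n\times n}$ with $F$ singular and $sF-G$ a regular pencil, and let $B\in\mathcal{F}^{n\times l}$, $C\in\mathcal{F}^{m\times n}$, $k_0\in\mathbb{Z}$. Consider the system $$FY_{k+1}=GY_k+BV_k,\qquad X_k=CY_k,\qquad k\ge k_0,$$ and let $H_q$, $Q_q$, $B_q$, $q_*$ be the Weierstrass data described in the context. Then causality between output and input holds for this system if and only if $$CQ_qH_q^iB_q=0_{m,l}\qquad\text{for every } i=1,2,\dots,q_*-1,$$ where $0_{m,l}$ is the $m\times l$ zero matrix.
   Context: $\mathcal{F}$ is a field over which the Weierstrass decomposition below exists (e.g. $\mathcal{F}=\mathbb{C}$). The pencil $sF-G$ is regular if $\det(sF-G)$ is not the zero polynomial in the indeterminate $s$. $Y_k\in\mathcal{F}^n$ is the state, $V_k\in\mathcal{F}^l$ the input (an arbitrary sequence $(V_k)_{k\ge k_0}$), and $X_k\in\mathcal{F}^m$ the output. Causality between output and input: for every $k>k_0$ the output $X_k$ is completely determined by the initial state $Y_{k_0}$ and the former inputs $V_{k_0},V_{k_0+1},\dots,V_k$. That is, if two solutions $(Y_k)$, $(Y_k')$ of the system correspond to input sequences $(V_k)$, $(V_k')$ with $Y_{k_0}=Y'_{k_0}$ and $V_i=V_i'$ for $k_0\le i\le k$, then $CY_k=CY'_k$. Weierstrass data: by regularity there are nonsingular $P,Q\in\mathcal{F}^{n\times n}$ with $PFQ=I_p\oplus H_q$ and $PGQ=J_p\oplus I_q$, where $p+q=n$ and $\oplus$ denotes block-diagonal direct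 sum. Here $J_p$ is a direct sum of Jordan blocks for the finite eigenvalues of the pencil, and $H_q$ is a direct sum of nilpotent Jordan blocks (ones on the superdiagonal, zeros elsewhere). The number $q_*$ is the nilpotency index of $H_q$, i.e. its largest block size. Such $P,Q$ are fixed. Write $Q=[\,Q_p\ \ Q_q\,]$ with $Q_p\in\mathcal{F}^{n\times p}$, $Q_q\in\mathcal{F}^{n\times q}$, and $PB=\begin{bmatrix} B_p \\ B_q \end{bmatrix}$ with $B_p\in\mathcal{F}^{p\times l}$, $B_q\in\mathcal{F}^{q\times l}$. *)

(* Defs.v *)
From mathcomp Require Import all_boot all_order all_algebra.

Set Implicit Arguments.
Unset Strict Implicit.
Unset Printing Implicit Defensive.

Import Order.TTheory GRing.Theory Num.Theory.
Local Open Scope ring_scope.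

Section Pencil.
Variable K : fieldType.

Definition pencil n (F G : 'M[K]_n) : 'M[{poly K}]_n :=
  'X *: map_mx polyC F - map_mx polyC G.

Definition regular_pencil n (F G : 'M[K]_n) : Prop := \det (pencil F G) != 0.

Definition finite_eigenvalue n (F G : 'M[K]_n) : pred K :=
  fun a => root (\det (pencil F G)) a.

Definition jordan_block d (a : K) : 'M[K]_d :=
  \matrix_(i, j) (if i == j then a else (i.+1 == j :> nat)%:R).

Definition jordan_sum r (d : 'I_r -> nat) (a : 'I_r -> K) :
    'M[K]_(\sum_i d i) :=
  \mxdiag_(i < r) jordan_block (d i) (a i).

(* The cast is needed because the size of a \mxdiag is syntactically the sum
   of the block sizes. The case r = 0 is the empty matrix (n = 0). *)
Definition is_jordan_sum (S : pred K) n (A : 'M[K]_n) : Prop :=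
  exists (r : nat) (d : 'I_r -> nat) (a : 'I_r -> K) (e : (\sum_i d i)%N = n),
    [/\ forall i, (0 < d i)%N,
        forall i, S (a i) &
        A = castmx (e, e) (jordan_sum d a)].

(* The least k <= n such that A ^+ k = 0, and n.+1 if there is none, which
   happens exactly when A is not nilpotent. *)
Definition nilpotency_index n (A : 'M[K]_n) : nat :=
  find (fun k => A ^+ k == 0) (iota 0 n.+1).

Definition weierstrass_form n (F G : 'M[K]_n) p q (npq : (p + q)%N = n)
    (P Q : 'M[K]_n) (J : 'M[K]_p) (H : 'M[K]_q) : Prop :=
  [/\ (P \in unitmx) && (Q \in unitmx),
      is_jordan_sum (finite_eigenvalue F G) J,
      is_jordan_sum (pred1 0) H,
      P *m F *m Q = castmx (npq, npq) (block_mx 1%:M 0 0 H) &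
      P *m G *m Q = castmx (npq, npq) (block_mx J 0 0 1%:M)].

(* Sequences are indexed by all of int; their values before k0 are never used. *)
Definition trajectory n l m (F G : 'M[K]_n) (B : 'M[K]_(n, l))
    (C : 'M[K]_(m, n)) (k0 : int)
    (V : int -> 'cV[K]_l) (Y : int -> 'cV[K]_n) (X : int -> 'cV[K]_m) : Prop :=
  forall k : int, k0 <= k ->
    F *m Y (k + 1) = G *m Y k + B *m V k /\ X k = C *m Y k.

Definition output_causal n l m (F G : 'M[K]_n) (B : 'M[K]_(n, l))
    (C : 'M[K]_(m, n)) (k0 : int) : Prop :=
  forall k : int, k0 < k ->
  forall (V V' : int -> 'cV[K]_l) (Y Y' : int -> 'cV[K]_n)
         (X X' : int -> 'cV[K]_m),
    trajectory F G B C k0 V Y X -> trajectory F G B C k0 V' Y' X' ->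
    Y k0 = Y' k0 -> (forall i : int, k0 <= i <= k -> V i = V' i) ->
    X k = X' k.

Lemma jordan_block0_exp d k :
  jordan_block d 0 ^+ k = \matrix_(i, j) (i + k == j :> nat)%N%:R.
Proof.
elim: k => [|k IH]; first by apply/matrixP=> i j; rewrite !mxE addn0.
rewrite exprSr IH; apply/matrixP=> i j; rewrite !mxE.
case: (ltnP (i + k) d) => [lt_d|ge_d].
  rewrite (bigD1 (Ordinal lt_d)) //= !mxE eqxx mul1r big1 ?addr0.
    rewrite addnS; case: (Ordinal lt_d =P j) => // <- /=.
    by rewrite gtn_eqF.
  move=> t ne; rewrite !mxE; case: eqP => [e|]; last by rewrite mul0r.
  by case/eqP: ne; apply: val_inj.
rewrite big1 => [|t _].
  by rewrite gtn_eqF //; apply: leq_trans (ltn_ord j) _; rewrite addnS ltnW.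
by rewrite !mxE gtn_eqF ?mul0r //; apply: leq_trans (ltn_ord t) _.
Qed.

Lemma jordan_block0_exp_eq0 d k : (jordan_block d 0 ^+ k == 0) = (d <= k)%N.
Proof.
rewrite jordan_block0_exp; apply/eqP/idP => [|le_dk].
  case: ltnP => // lt_kd /matrixP.
  have d_gt0 : (0 < d)%N by apply: leq_trans lt_kd.
  move/(_ (Ordinal d_gt0) (Ordinal lt_kd))/eqP.
  by rewrite !mxE /= add0n eqxx oner_eq0.
apply/matrixP => i j; rewrite !mxE gtn_eqF //.
by apply: leq_trans (ltn_ord j) _; rewrite (leq_trans le_dk) ?leq_addl.
Qed.

Lemma mxdiag_exp r (d : 'I_r -> nat) (A : forall i, 'M[K]_(d i)) k :
  (\mxdiag_(i < r) A i) ^+ k = \mxdiag_(i < r) (A i ^+ k).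
Proof.
elim: k => [|k IH]; first by rewrite expr0 -[1]mxdiagZ.
rewrite exprSr IH [LHS]mul_mxblock_mxdiag; apply/eq_mxblockP => i j.
rewrite exprSr; case: (eqVneq i j) => [<-|_]; first by rewrite !conform_mx_id.
by rewrite mul0mx.
Qed.

Lemma nilpotency_index_jordan r (d : 'I_r -> nat) n
    (e : (\sum_i d i)%N = n) :
  nilpotency_index (castmx (e, e) (jordan_sum d (fun=> 0)))
    = (\max_(i < r) d i)%N.
Proof.
subst n; rewrite castmx_id /nilpotency_index /jordan_sum.
set m := (\max_(i < r) d i)%N; set n := (\sum_i d i)%N.
have eqP0 k : (\mxdiag_(i < r) jordan_block (d i) 0) ^+ k == 0 = (m <= k)%N.
  rewrite mxdiag_exp -(@mxdiag0 _ r d); apply/eqP/bigmax_leqP.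
    by move/eq_mxdiagP=> h i _; rewrite -jordan_block0_exp_eq0 h.
  by move=> h; apply/eq_mxdiagP=> i; apply/eqP; rewrite jordan_block0_exp_eq0 h.
rewrite (eq_find eqP0).
have le_mn : (m <= n)%N.
  by apply/bigmax_leqP=> i _; rewrite /n (bigD1 i) //= leq_addr.
have -> : n.+1 = (m + (n.+1 - m))%N by rewrite subnKC // ltnW.
rewrite iotaD find_cat size_iota.
rewrite ifN; last first.
  by apply/hasPn=> k; rewrite mem_iota add0n => /= lt_km; rewrite -ltnNge.
by rewrite subSn //= add0n leqnn addn0.
Qed.

End Pencil.

(* Main.v *)
(** In Weierstrass coordinates [Y = Qp zp + Qq zq] the system splits into the
    forward recursion [zp (k+1) = J zp k + Bp V k] and the backward recursion
    [zq k = H zq (k+1) - Bq V k], and nilpotency of [H] solves the latter as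
    [zq k = - \sum_i H^i Bq V (k+i)].  Hence [C Qq H^i Bq] is, up to sign, the
    influence of the future input [V (k+i)] on [X k].  For necessity, a single
    impulse is placed at time [k0 + nu + i], with [nu] the nilpotency index: that
    is late enough for the initial state to remain zero. *)
Require Import Defs.
From mathcomp Require Import all_boot all_order all_algebra.
From mathcomp Require Import zify.

Import Order.TTheory GRing.Theory Num.Theory.
Local Open Scope ring_scope.

Lemma expmxS (K : fieldType) n (A : 'M[K]_n) k : A ^+ k.+1 = A *m A ^+ k.
Proof. exact: exprS. Qed.

Lemma expmxSr (K : fieldType) n (A : 'M[K]_n) k : A ^+ k.+1 = A ^+ k *m A.
Proof. exact: exprSr. Qed.

(** Every block has size at most [n], so [A ^+ n = 0]. Hence the search defining [nilpotency_index]
    succeeds and does not return its default [n.+1]. *)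
Lemma jordan_sum0_nilpotent (K : fieldType) n (A : 'M[K]_n) :
  is_jordan_sum (pred1 0) A -> A ^+ nilpotency_index A = 0.
Proof.
move=> [r [d [a [e [_ a0 ->]]]]]; subst n; rewrite castmx_id.
set A0 := jordan_sum d a; set n := (\sum_i d i)%N.
have A0n : A0 ^+ n = 0.
  rewrite /A0 /jordan_sum mxdiag_exp -(@mxdiag0 _ r d).
  apply/eq_mxdiagP => i; apply/eqP.
  by rewrite (eqP (a0 i)) jordan_block0_exp_eq0 /n (bigD1 i) //= leq_addr.
have hasA : has (fun k => A0 ^+ k == 0) (iota 0 n.+1).
  by apply/hasP; exists n; rewrite ?mem_iota ?leqnn //=; apply/eqP.
have := nth_find 0%N hasA; rewrite nth_iota; first by move/eqP.
by rewrite -[X in (_ < X)%N](size_iota 0) -has_find.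
Qed.

(** Left multiplication by the invertible [P] is injective, so the split is an equivalence: one
    direction analyses given trajectories, the other builds new ones. *)
Lemma weierstrass_step (K : fieldType) p q l
    (F G : 'M[K]_(p + q)) (B : 'M[K]_(p + q, l))
    (P Q : 'M[K]_(p + q)) (J : 'M[K]_p) (H : 'M[K]_q)
    (Bp : 'M[K]_(p, l)) (Bq : 'M[K]_(q, l))
    (zp zp' : 'cV[K]_p) (zq zq' : 'cV[K]_q) (v : 'cV[K]_l) :
  P \in unitmx ->
  P *m F *m Q = block_mx 1%:M 0 0 H -> P *m G *m Q = block_mx J 0 0 1%:M ->
  P *m B = col_mx Bp Bq ->
  F *m (Q *m col_mx zp' zq') = G *m (Q *m col_mx zp zq) + B *m v <->
  zp' = J *m zp + Bp *m v /\ H *m zq' = zq + Bq *m v.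
Proof.
move=> Pu PFQ PGQ PB.
have EF : P *m (F *m (Q *m col_mx zp' zq')) = col_mx zp' (H *m zq').
  by rewrite !mulmxA PFQ mul_block_col !mul0mx !mul1mx addr0 add0r.
have EG : P *m (G *m (Q *m col_mx zp zq) + B *m v)
        = col_mx (J *m zp + Bp *m v) (zq + Bq *m v).
  rewrite mulmxDr !mulmxA PGQ PB mul_block_col !mul0mx !mul1mx addr0 add0r.
  by rewrite mul_col_mx add_col_mx.
split=> [/(congr1 (mulmx P))|[ep eq]].
  by rewrite EF EG => /eq_col_mx.
by apply: (can_inj (mulKmx Pu)); rewrite EF EG ep eq.
Qed.

(** Induction on [N], substituting [z (k + N) = H z (k + N + 1) - Bq V (k + N)] into the remainder
    term. *)
Lemma backward_unroll (K : fieldType) q l (H : 'M[K]_q) (Bq : 'M[K]_(q, l))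
    (k0 : int) (z : int -> 'cV[K]_q) (V : int -> 'cV[K]_l) :
  (forall k, k0 <= k -> H *m z (k + 1) = z k + Bq *m V k) ->
  forall N k, k0 <= k ->
  z k = H ^+ N *m z (k + N%:Z) - \sum_(i < N) H ^+ i *m Bq *m V (k + i%:Z).
Proof.
move=> step; elim=> [|N IH] k le_k.
  by rewrite big_ord0 subr0 addr0 [H ^+ 0]expr0 [RHS]mul1mx.
rewrite big_ord_recr /= expmxSr (IH k le_k) -mulmxA.
have -> : k + N.+1%:Z = k + N%:Z + 1 by lia.
rewrite step; last by lia.
by rewrite mulmxDr mulmxA opprD [- _ + _]addrC addrA addrK.
Qed.

Lemma impulse_response (K : fieldType) p q l
    (J : 'M[K]_p) (H : 'M[K]_q) (Bp : 'M[K]_(p, l)) (Bq : 'M[K]_(q, l))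
    (s : int) (v : 'cV[K]_l) :
  exists (zp : int -> 'cV[K]_p) (zq : int -> 'cV[K]_q),
    [/\ forall k, zp (k + 1) = J *m zp k + Bp *m (if k == s then v else 0),
        forall k, H *m zq (k + 1) = zq k + Bq *m (if k == s then v else 0),
        forall k, k <= s -> zp k = 0 &
        forall i : nat, zq (s - i%:Z) = - (H ^+ i *m Bq *m v)].
Proof.
(* The forward part is at rest through time [s] and first reacts at [s + 1], with exponent 0, hence
   the predecessor. The backward part anticipates the impulse and vanishes after [s]. *)
exists (fun k => if k <= s then 0 else J ^+ (absz (k - s)%R).-1 *m Bp *m v).
exists (fun k => if k <= s then - (H ^+ (absz (s - k)%R) *m Bq *m v) else 0).
split=> [k|k|k -> //|i].
- case: (ltgtP k s) => [lt_ks|gt_ks|->].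
  + by rewrite ifT ?mulmx0 ?addr0 //; lia.
  + rewrite ifF; last by lia.
    have -> : (absz (k + 1 - s)%R).-1 = (absz (k - s)%R).-1.+1 by lia.
    by rewrite expmxS !mulmxA mulmx0 addr0.
  + rewrite ifF; last by lia.
    have -> : (absz (s + 1 - s)%R).-1 = 0%N by lia.
    by rewrite [J ^+ 0]expr0 mulmx0 add0r [_ *m Bp]mul1mx.
- case: (ltgtP k s) => [lt_ks|gt_ks|->].
  + rewrite ifT; last by lia.
    have -> : (absz (s - k)%R) = (absz (s - (k + 1))%R).+1 by lia.
    by rewrite expmxS mulmx0 addr0 mulmxN !mulmxA.
  + by rewrite ifF ?mulmx0 ?addr0 //; lia.
  + rewrite ifF; last by lia.
    by rewrite subrr [H ^+ _]expr0 [1 *m Bq]mul1mx mulmx0 addNr.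
- rewrite ifT; last by lia.
  by have -> : (absz (s - (s - i%:Z))%R) = i by lia.
Qed.

Theorem proposition3p2 (K : fieldType) (n l m : nat)
    (F G : 'M[K]_n) (B : 'M[K]_(n, l)) (C : 'M[K]_(m, n)) (k0 : int)
    (F_singular : F \notin unitmx)
    (FG_regular : regular_pencil F G)
    (p q : nat) (npq : (p + q)%N = n)
    (P Q : 'M[K]_n) (J : 'M[K]_p) (H : 'M[K]_q)
    (PQ_weierstrass : weierstrass_form F G npq P Q J H)
    (Qp : 'M[K]_(n, p)) (Qq : 'M[K]_(n, q))
    (Q_split : Q = castmx (erefl n, npq) (row_mx Qp Qq))
    (Bp : 'M[K]_(p, l)) (Bq : 'M[K]_(q, l))
    (PB_split : P *m B = castmx (npq, erefl l) (col_mx Bp Bq)) :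
  output_causal F G B C k0 <->
  (forall i : nat, (1 <= i <= nilpotency_index H - 1)%N ->
     C *m Qq *m H ^+ i *m Bq = 0).
Proof.
case: PQ_weierstrass => /andP[Pu Qu] _ /jordan_sum0_nilpotent Hnil.
subst n; rewrite !castmx_id in Q_split PB_split *; move=> PFQ PGQ.
set nu := nilpotency_index H in Hnil *.
have stepP zp zp' zq zq' v :=
  weierstrass_step K p q l F G B P Q J H Bp Bq zp zp' zq zq' v Pu PFQ PGQ PB_split.
split=> [causal i /andP[i_gt0 i_le]|markov0].
(* The matrix is tested column by column: column [j] is its product with the unit vector [v], which
   becomes the impulse. *)
- apply: trmx_inj; apply/row_matrixP => j; rewrite trmx0 row0 -tr_col colE.
  set v := delta_mx _ _; apply: trmx_inj; rewrite trmxK trmx0.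
  set s := k0 + nu%:Z + i%:Z.
  have [zp [zq [zpS zqS zp0 zqE]]] := impulse_response _ _ _ _ J H Bp Bq s v.
  pose V k := if k == s then v else 0.
  pose Y k := Q *m col_mx (zp k) (zq k).
  (* The output is observed [i] steps before the impulse; the range of [i] forces [nu] to be at
     least 2, so this time is later than [k0]. *)
  have lt_k : k0 < k0 + nu%:Z by lia.
  have tr : trajectory F G B C k0 V Y (fun k => C *m Y k).
    by move=> k _; split=> //; apply/stepP; split; [apply: zpS | apply: zqS].
  have tr0 : trajectory F G B C k0 (fun=> 0) (fun=> 0) (fun=> 0).
    by move=> k _; rewrite !mulmx0 addr0.
  have Y0 : Y k0 = 0.
    rewrite /Y zp0; last by lia.
    (* At [k0] the backward part carries the factor [H ^+ (i + nu)], which is zero. *)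
    have -> : k0 = s - (i + nu)%N%:Z by rewrite /s; lia.
    rewrite zqE exprD Hnil mulr0 !mul0mx oppr0.
    by rewrite col_mx0 mulmx0.
  have V0 k : k0 <= k <= k0 + nu%:Z -> V k = 0.
    by move=> le_k; rewrite /V ifF //; rewrite /s; lia.
  have := causal _ lt_k _ _ _ _ _ _ tr tr0 Y0 V0.
  rewrite /Y zp0; last by rewrite /s; lia.
  have -> : k0 + nu%:Z = s - i%:Z by rewrite /s; lia.
  rewrite zqE Q_split mul_row_col mulmx0 add0r !mulmxN => /eqP.
  by rewrite oppr_eq0 => /eqP; rewrite !mulmxA.
- move=> k lt_k V V' Y Y' X X' tr tr' Y0 VV.
  (* By linearity the difference of the trajectories solves the system with input [U], which
     vanishes from [k0] to [k]. *)
  pose U t := V t - V' t; pose w t := invmx Q *m (Y t - Y' t).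
  pose zp t := usubmx (w t); pose zq t := dsubmx (w t).
  have QzE t : Q *m col_mx (zp t) (zq t) = Y t - Y' t.
    by rewrite vsubmxK mulKVmx.
  have step t : k0 <= t -> zp (t + 1) = J *m zp t + Bp *m U t
                        /\ H *m zq (t + 1) = zq t + Bq *m U t.
    move=> le_t; apply/stepP; rewrite !QzE !mulmxBr.
    by rewrite (tr t le_t).1 (tr' t le_t).1 opprD addrACA.
  have zp0 (t : nat) : k0 + t%:Z <= k -> zp (k0 + t%:Z) = 0.
    elim: t => [|t IH] le_t; first by rewrite /zp /w addr0 Y0 subrr mulmx0 linear0.
    have -> : k0 + t.+1%:Z = k0 + t%:Z + 1 by lia.
    rewrite (step _ _).1; last by lia.
    rewrite IH; last by lia.
    by rewrite /U VV ?subrr ?mulmx0 ?addr0 //; lia.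
  have zpk : zp k = 0.
    have -> : k = k0 + (absz (k - k0)%R)%:Z by lia.
    by apply: zp0; lia.
  have le_k : k0 <= k by lia.
  apply/eqP; rewrite -subr_eq0 (tr k le_k).2 (tr' k le_k).2 -mulmxBr -QzE zpk.
  rewrite Q_split mul_row_col mulmx0 add0r.
  (* Unrolling [nu] steps kills the remainder. In the sum, the term of index 0 vanishes because the
     inputs agree at [k]; the indices from 1 to [nu - 1] are those covered by [markov0]. *)
  rewrite (backward_unroll _ _ _ _ _ _ _ _ (fun t le_t => (step t le_t).2) nu _ le_k) Hnil.
  rewrite mul0mx sub0r !mulmxN oppr_eq0 !mulmx_sumr big1 // => -[[|i] lt_i] _ /=.
    by rewrite addr0 /U VV ?subrr ?mulmx0 //; lia.
  by rewrite !mulmxA markov0 ?mul0mx //; lia.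
Qed.
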